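(* Let $n$ be a positive integer. Suppose that statement $(A_l)$ holds for every integer $1\leq l<n$ and statement $(B_l)$ holds for every integer $0\leq l<n$. Then statement $(A_n)$ holds.
   Context: For positive integers $k_1,\ldots,k_r$ with $k_1\geq 2$, $\zeta^\star(k_1,\ldots,k_r)=\sum_{m_1\geq\cdots\geq m_r\geq 1} m_1^{-k_1}\cdots m_r^{-k_r}$, and $\{2\}^j$ denotes $j$ copies of $2$. $\mathfrak{S}_N$ denotes the symmetric group on $\{0,1,\ldots,N-1\}$. Statement $(A_n)$ (for $n\geq 1$): for all non-negative integers $j_0,\ldots,j_{2n-1}$, with $m=j_0+\cdots+j_{2n-1}$, \[\sum_{\sigma\in\mathfrak{S}_{2n}}\zeta^\star(\{2\}^{j_{\sigma(0)}},3,\{2\}^{j_{\sigma(1)}},1,\{2\}^{j_{\sigma(2)}},3,\ldots,\{2\}^{j_{\sigma(2n-2)}},3,\{2\}^{j_{\sigma(2n-1)}},1)\in\mathbb{Q}\cdot\pi^{2m+4n}\] (the index alternates blocks $\{2\}^{j_{\sigma(2i)}},3,\{2\}^{j_{\sigma(2i+1)}},1$ for $i=0,\ldots,n-1$). Statement $(B_n)$ (for $n\geq 0$): for all non-negative integers $j_0,\ldots,j_{2n}$, with $m=j_0+\cdots+j_{2n}$, \[\sum_{\sigma\in\mathfrak{S}_{2n+1}}\zeta^\star(\{2\}^{j_{\sigma(0)}},3,\{2\}^{j_{\sigma(1)}},1,\ldots,\{2\}^{j_{\sigma(2n-2)}},3,\{2\}^{j_{\sigma(2n-1)}},1,\{2\}^{j_{\sigma(2n)}+1})\in\mathbb{Q}\cdot\pi^{2m+4n+2}\]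 (blocks $\{2\}^{j_{\sigma(2i)}},3,\{2\}^{j_{\sigma(2i+1)}},1$ for $i=0,\ldots,n-1$, followed by $\{2\}^{j_{\sigma(2n)}+1}$). *)

(* Defs.v *)
From HB Require Import structures.
From mathcomp Require Import all_boot all_order all_algebra all_fingroup.
From mathcomp Require Import all_classical all_reals all_analysis.
Set Implicit Arguments. Unset Strict Implicit. Unset Printing Implicit Defensive.
Import Order.TTheory GRing.Theory Num.Theory numFieldNormedType.Exports.
Local Open Scope ring_scope.

Fixpoint zsum (R : realType) (ks : seq nat) (M : nat) : R :=
  match ks with
  | [::] => 1
  | k :: ks' => \sum_(1 <= m < M.+1) (m%:R ^- k) * zsum R ks' m
  end.

(* multiple zeta-star value: limit of the truncated sums (convergent when k_1 >= 2) *)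
Definition zetastar (R : realType) (ks : seq nat) : R := limn (zsum R ks).

Definition permj (N : nat) (s : 'S_N) (j : 'I_N -> nat) (k : nat) : nat :=
  if @insub nat (fun x => x < N)%N 'I_N k is Some i then j (s i) else 0%N.

Definition idxA (n : nat) (J : nat -> nat) : seq nat :=
  flatten [seq nseq (J i.*2) 2%N ++ 3%N :: nseq (J i.*2.+1) 2%N ++ [:: 1%N]
          | i <- iota 0 n].

Definition idxB (n : nat) (J : nat -> nat) : seq nat :=
  idxA n J ++ nseq (J n.*2).+1 2%N.

Definition in_Qpi (R : realType) (x : R) (w : nat) : Prop :=
  exists q : rat, x = ratr q * pi ^+ w.

Definition stmtA (R : realType) (n : nat) : Prop :=
  forall j : 'I_(n.*2) -> nat,
    in_Qpi (\sum_(s : 'S_(n.*2)) zetastar R (idxA n (permj s j)))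
           (2 * (\sum_(i < n.*2) j i) + 4 * n)%N.

Definition stmtB (R : realType) (n : nat) : Prop :=
  forall j : 'I_(n.*2.+1) -> nat,
    in_Qpi (\sum_(s : 'S_(n.*2.+1)) zetastar R (idxB n (permj s j)))
           (2 * (\sum_(i < n.*2.+1) j i) + 4 * n + 2)%N.

(* Main.v *)
Require Import Defs.
From mathcomp Require Import all_boot all_order all_algebra all_fingroup.
From mathcomp Require Import all_classical all_reals all_analysis.
From mathcomp Require Import ring lra zify.

(* Put f_j(k) = (-1)^k / k^(2j+2).  Expanding the truncated sums of
   {2}^{j_0},3,{2}^{j_1},1,... on the kernel C(2N,N+l) / C(2N,N), which tends
   to 1 as N grows, gives
     zeta*({2}^{j_0},3,{2}^{j_1},1,...,{2}^{j_(2n-1)},1) =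
       sum over l_0 >= l_1 >= ... >= l_(2n-1) >= 1 of
         2^#{l_0,...,l_(2n-1)} f_{j_0}(l_0) ... f_{j_(2n-1)}(l_(2n-1)).
   Symmetrizing over the j_i yields a polarized coefficient of
   prod_k (1 + x_k) / (1 - x_k), hence a rational polynomial in the power sums
   of products of an odd number of the f_j.  Such a product is again some f_j,
   and 2 sum_k f_j(k) = - zeta*({2}^{j+1}) is in Q pi^(2j+2) by (B_0). *)

Set Implicit Arguments. Unset Strict Implicit. Unset Printing Implicit Defensive.
Import Order.TTheory GRing.Theory Num.Theory numFieldNormedType.Exports.
Local Open Scope classical_set_scope.
Local Open Scope ring_scope.

(** * Symmetrized sums *)

(** Entries are picked by position, so equal letters count separately, as in a sum over the
    symmetric group. *)
Fixpoint picks (T : Type) (s : seq T) : seq (T * seq T) :=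
  if s is x :: s' then (x, s') :: [seq (p.1, x :: p.2) | p <- picks s']
  else [::].

Lemma big_picks_swap (V : nmodType) (T : Type) (s : seq T)
    (F : T -> T -> seq T -> V) :
  \sum_(p <- picks s) \sum_(q <- picks p.2) F p.1 q.1 q.2 =
  \sum_(p <- picks s) \sum_(q <- picks p.2) F q.1 p.1 q.2.
Proof.
elim: s F => [|x s IHs] F /=; first by rewrite !big_nil.
rewrite !big_cons !big_map /=.
have cons (G : T -> T -> seq T -> V) :
    \sum_(p <- picks s) \sum_(q <- picks (x :: p.2)) G p.1 q.1 q.2 =
    \sum_(p <- picks s) G p.1 x p.2 +
    \sum_(p <- picks s) \sum_(q <- picks p.2) G p.1 q.1 (x :: q.2).
  by rewrite -big_split; apply: eq_bigr => p _; rewrite big_cons big_map.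
rewrite (cons F) (cons (fun a b => F b a)) (IHs (fun a b t => F a b (x :: t))).
rewrite !addrA.
by congr (_ + _); rewrite addrC.
Qed.

(** Two exchanges of neighbouring picks bring the third pick to the front. *)
Lemma big_picks_rot (V : nmodType) (T : Type) (s : seq T)
    (F : T -> T -> T -> seq T -> V) :
  \sum_(p <- picks s) \sum_(q <- picks p.2) \sum_(r <- picks q.2)
     F p.1 q.1 r.1 r.2 =
  \sum_(r <- picks s) \sum_(p <- picks r.2) \sum_(q <- picks p.2)
     F p.1 q.1 r.1 q.2.
Proof.
rewrite [RHS](big_picks_swap s (fun r p t => \sum_(q <- picks t) F p q.1 r q.2)).
apply: eq_bigr => p _.
exact: (big_picks_swap p.2 (fun q r t => F p.1 q r t)).
Qed.

Lemma size_picks (T : eqType) (s : seq T) (p : T * seq T) :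
  p \in picks s -> size s = (size p.2).+1.
Proof.
elim: s p => [|x s IHs] p //=; rewrite inE => /orP[/eqP-> //|/mapP[q qs ->]] /=.
by rewrite (IHs q).
Qed.

Lemma big_picks_sum (T : eqType) (F : T -> nat) (s : seq T) (p : T * seq T) :
  p \in picks s -> (\sum_(x <- s) F x = F p.1 + \sum_(x <- p.2) F x)%N.
Proof.
elim: s p => [|x s IHs] p //=; rewrite inE => /orP[/eqP-> |/mapP[q qs ->]] /=.
  by rewrite big_cons.
by rewrite !big_cons (IHs q) // addnCA.
Qed.

(* Sums over l >= k_1 >= ... >= k_r >= 1 of f a_1 k_1 ... f a_r k_r, weighted by
   2 ^ (number of distinct k_i). *)
Fixpoint isum (R : numFieldType) (T : Type) (f : T -> nat -> R) (w : seq T)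
    (l : nat) : R :=
  if w is a :: w' then
    \sum_(1 <= k < l.+1) f a k * (isum f w' k + isum f w' k.-1)
  else 1.

(* The sum of isum over all orderings of s; n is fuel and must be size s (the
   value is 0 for larger n). *)
Fixpoint symsum_rec (R : numFieldType) (T : Type) (f : T -> nat -> R)
    (n : nat) (s : seq T) (l : nat) : R :=
  if n is n'.+1 then
    \sum_(1 <= k < l.+1) \sum_(p <- picks s)
       f p.1 k * (symsum_rec f n' p.2 k + symsum_rec f n' p.2 k.-1)
  else 1.

Definition symsum (R : numFieldType) (T : Type) (f : T -> nat -> R)
  (s : seq T) : nat -> R := symsum_rec f (size s) s.

Lemma symsum_cons0 (R : numFieldType) (T : Type) (f : T -> nat -> R) a s :
  symsum f (a :: s) 0 = 0.
Proof. by rewrite /symsum /= big_geq. Qed.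

Lemma symsum_cons (R : numFieldType) (T : eqType) (f : T -> nat -> R) a s l :
  symsum f (a :: s) l = \sum_(1 <= k < l.+1) \sum_(p <- picks (a :: s))
     f p.1 k * (symsum f p.2 k + symsum f p.2 k.-1).
Proof.
apply: eq_bigr => k _; apply: eq_big_seq => p /(@size_picks _ (a :: s))[sz].
by rewrite /symsum -sz.
Qed.

Lemma symsumS (R : numFieldType) (T : eqType) (f : T -> nat -> R) s l :
  symsum f s l.+1 = symsum f s l + \sum_(p <- picks s)
     f p.1 l.+1 * (symsum f p.2 l.+1 + symsum f p.2 l).
Proof.
case: s => [|a s]; first by rewrite big_nil addr0.
by rewrite !symsum_cons big_nat_recr.
Qed.

Lemma symsum_consS (R : numFieldType) (T : eqType) (f : T -> nat -> R) a s l :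
  symsum f (a :: s) l.+1 = symsum f (a :: s) l +
    (f a l.+1 * (symsum f s l.+1 + symsum f s l) + \sum_(p <- picks s)
     f p.1 l.+1 * (symsum f (a :: p.2) l.+1 + symsum f (a :: p.2) l)).
Proof. by rewrite symsumS /= big_cons big_map. Qed.

Lemma isum1S (R : numFieldType) (T : Type) (f : T -> nat -> R) g l :
  isum f [:: g] l.+1 = isum f [:: g] l + 2 * f g l.+1.
Proof. by rewrite /= big_nat_recr //= mulrC -mulr2n. Qed.

(* With x_k the generic linear combination of the letters at k, the generating
   function of the symmetrized sums is G = prod_k (1 + x_k) / (1 - x_k); the
   lemma is the identity 1 / (1 - x^2) = 1 + x^2 / (1 - x^2) applied to the
   logarithmic derivative of G in the direction g. *)
Lemma symsum_newton (R : numFieldType) (T : eqType) (f : T -> nat -> R)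
    (mul : T -> T -> T -> T)
    (fM : forall a b c k, f (mul a b c) k = f a k * f b k * f c k) g s l :
  symsum f (g :: s) l = isum f [:: g] l * symsum f s l +
    \sum_(p <- picks s) \sum_(q <- picks p.2) symsum f (mul g p.1 q.1 :: q.2) l.
Proof.
(* Strong induction on the size of [s], with an inner induction on [l]. *)
have [n] := ubnP (size s); elim: n => // n IHn in s l *; rewrite ltnS => sn.
elim: l => [|l IHl].
  rewrite symsum_cons0 /= big_geq // mul0r add0r big1 // => p _.
  by rewrite big1 // => q _; rewrite symsum_cons0.
rewrite symsum_consS IHl.
under [in RHS]eq_bigr => p _ do under eq_bigr => q _ do
  rewrite symsum_consS fM.
set m := fun t => symsum f t l.+1 + symsum f t l.
(* The outer hypothesis applies to the shorter list [p.2], at both [l.+1] and [l]. *)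
have -> : \sum_(p <- picks s) f p.1 l.+1 *
     (symsum f (g :: p.2) l.+1 + symsum f (g :: p.2) l) =
  \sum_(p <- picks s) f p.1 l.+1 * (
     isum f [:: g] l.+1 * symsum f p.2 l.+1 + isum f [:: g] l * symsum f p.2 l
     + \sum_(q <- picks p.2) \sum_(r <- picks q.2) m (mul g q.1 r.1 :: r.2)).
  rewrite big_seq [RHS]big_seq; apply: eq_bigr => p ps.
  have szp : (size p.2 < n)%N by rewrite (leq_trans _ sn) // (size_picks ps).
  rewrite !IHn //; congr (_ * _).
  rewrite addrACA -big_split; congr (_ + _); apply: eq_bigr => q _.
  by rewrite -big_split.
rewrite isum1S [symsum f s l.+1]symsumS.
set D := \sum_(p <- picks s) f p.1 l.+1 * (symsum f p.2 l.+1 + _).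
set A := isum _ _ _; set S := symsum f s l;
set P2 := \sum_(p <- picks s) \sum_(q <- _) symsum f _ l.
have -> : \sum_(p <- picks s) \sum_(q <- picks p.2)
   (symsum f (mul g p.1 q.1 :: q.2) l +
    (f g l.+1 * f p.1 l.+1 * f q.1 l.+1 * (symsum f q.2 l.+1 + symsum f q.2 l)
    + \sum_(r <- picks q.2) f r.1 l.+1 *
      (symsum f (mul g p.1 q.1 :: r.2) l.+1 + symsum f (mul g p.1 q.1 :: r.2) l)))
  = P2 + f g l.+1 * (\sum_(p <- picks s) f p.1 l.+1 *
           (symsum f p.2 l.+1 - symsum f p.2 l))
    + \sum_(p <- picks s) f p.1 l.+1 *
       \sum_(q <- picks p.2) \sum_(r <- picks q.2) m (mul g q.1 r.1 :: r.2).
  (* The letter evaluated at [l.+1], picked last on the right, is rotated to the front. *)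
  have -> : \sum_(p <- picks s) f p.1 l.+1 *
       (\sum_(q <- picks p.2) \sum_(r <- picks q.2) m (mul g q.1 r.1 :: r.2)) =
     \sum_(p <- picks s) \sum_(q <- picks p.2) \sum_(r <- picks q.2)
       f r.1 l.+1 * m (mul g p.1 q.1 :: r.2).
    rewrite (big_picks_rot s (fun p q r t => f r l.+1 * m (mul g p q :: t))).
    apply: eq_bigr => p _; rewrite big_distrr /=; apply: eq_bigr => q _.
    by rewrite big_distrr.
  rewrite mulr_sumr -!big_split /=; apply: eq_bigr => p _.
  (* The increment of [symsum f p.2] from [l] to [l.+1] is itself a sum over the picks of [p.2]. *)
  rewrite symsumS [_ + _ - _]addrAC subrr add0r 2!mulr_sumr -!big_split /=.
  by apply: eq_bigr => q _; rewrite -addrA !mulrA.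
(* With x = [f g l.+1]: (A + 2x) u + A v = (A + x)(u + v) + x (u - v). *)
have -> : \sum_(p <- picks s) f p.1 l.+1 * (
     (A + 2 * f g l.+1) * symsum f p.2 l.+1 + A * symsum f p.2 l
     + \sum_(q <- picks p.2) \sum_(r <- picks q.2) m (mul g q.1 r.1 :: r.2))
  = (A + f g l.+1) * D + f g l.+1 * (\sum_(p <- picks s) f p.1 l.+1 *
           (symsum f p.2 l.+1 - symsum f p.2 l)) +
    \sum_(p <- picks s) f p.1 l.+1 *
       \sum_(q <- picks p.2) \sum_(r <- picks q.2) m (mul g q.1 r.1 :: r.2).
  rewrite !mulr_sumr -!big_split /=; apply: eq_bigr => p _; ring.
ring.
Qed.

(** * Sums over orderings and over the symmetric group *)

Lemma picks_map (T U : Type) (h : T -> U) s :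
  picks (map h s) = [seq (h p.1, map h p.2) | p <- picks s].
Proof. by elim: s => //= x s ->; rewrite -!map_comp. Qed.

Lemma big_picks_uniq (V : nmodType) (T : eqType) (t : seq T)
    (G : T -> seq T -> V) : uniq t ->
  \sum_(p <- picks t) G p.1 p.2 = \sum_(x <- t) G x (rem x t).
Proof.
elim: t G => [|a t IHt] G /=; first by rewrite !big_nil.
case/andP=> at' ut; rewrite !big_cons big_map /= eqxx; congr (_ + _).
rewrite (IHt (fun x r => G x (a :: r))) //; apply: eq_big_seq => x xt.
by case: eqP => // ax; rewrite ax xt in at'.
Qed.

Lemma isum_map (R : numFieldType) (T U : Type) (h : T -> U)
    (f : U -> nat -> R) w l :
  isum f (map h w) l = isum (f \o h) w l.
Proof.
elim: w l => //= a w IHw l.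
by apply: eq_bigr => k _; rewrite !IHw.
Qed.

Lemma symsum_map (R : numFieldType) (T U : Type) (h : T -> U)
    (f : U -> nat -> R) s l :
  symsum f (map h s) l = symsum (f \o h) s l.
Proof.
rewrite /symsum size_map; move: (size s) => n; elim: n s l => //= n IHn s l.
apply: eq_bigr => k _; rewrite picks_map big_map; apply: eq_bigr => p _ /=.
by rewrite !IHn.
Qed.

(** [permutations] lists each distinct ordering once, hence [uniq t]; choosing the head of an
    ordering is then a pick. *)
Lemma sum_permutations_isum (R : numFieldType) (T : eqType)
    (f : T -> nat -> R) t l : uniq t ->
  \sum_(w <- permutations t) isum f w l = symsum f t l.
Proof.
have [n] := ubnP (size t); elim: n => // n IHn in t l *; rewrite ltnS.
case: t => [|a t] tn ut; first by rewrite big_seq1.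
rewrite (perm_big _ (permutationsE _)) // undup_id // big_allpairs_dep.
transitivity (\sum_(x <- a :: t) \sum_(1 <= k < l.+1) f x k *
    (symsum f (rem x (a :: t)) k + symsum f (rem x (a :: t)) k.-1)).
  apply: eq_big_seq => x xt; rewrite exchange_big; apply: eq_bigr => k _.
  have rn : (size (rem x (a :: t)) < n)%N by rewrite size_rem.
  by rewrite -mulr_sumr big_split !(IHn (rem x (a :: t))) ?rem_uniq.
rewrite exchange_big symsum_cons; apply: eq_bigr => k _.
by rewrite (big_picks_uniq (fun x r => f x k * (symsum f r k + symsum f r k.-1))).
Qed.

(** Distinct permutations give distinct orderings of [enum 'I_n], and there are n! of each. *)
Lemma sum_perm_permutations (V : nmodType) n (F : seq 'I_n -> V) :
  \sum_(s : 'S_n) F [seq s i | i <- enum 'I_n] =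
  \sum_(w <- permutations (enum 'I_n)) F w.
Proof.
pose g (s : 'S_n) := [seq s i | i <- enum 'I_n].
have ug : uniq (map g (index_enum 'S_n)).
  rewrite map_inj_uniq ?index_enum_uniq // => s t /eq_in_map st.
  by apply/permP => i; apply: st; rewrite mem_enum.
rewrite -(big_map g xpredT F); apply: perm_big.
apply: uniq_perm => //; first exact: permutations_uniq.
apply: (uniq_min_size ug _ _).2 => [w /mapP[s _ ->]|].
  rewrite mem_permutations; apply: uniq_perm; rewrite ?enum_uniq //.
    by rewrite map_inj_uniq ?enum_uniq //; exact: perm_inj.
  move=> i; rewrite mem_enum; apply/mapP; exists (s^-1 i)%g; rewrite ?mem_enum //.
  by rewrite permKV.
rewrite size_permutations ?enum_uniq // size_enum_ord size_map -card_Sn.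
by rewrite [index_enum _]unlock -enumT -cardE.
Qed.

(** Values of [j] may coincide, so the orderings are taken of the indices, which are distinct, and
    [j] is applied afterwards. *)
Lemma sum_perm_isum (R : numFieldType) n (j : 'I_n -> nat) (f : nat -> nat -> R) l :
  \sum_(s : 'S_n) isum f [seq permj s j i | i <- iota 0 n] l =
  symsum f [seq j i | i <- enum 'I_n] l.
Proof.
rewrite symsum_map -sum_permutations_isum ?enum_uniq //.
rewrite -sum_perm_permutations; apply: eq_bigr => s _.
rewrite -[RHS](isum_map j f) -val_enum_ord -!map_comp; congr (isum f _ l).
by apply: eq_map => i /=; rewrite /permj valK.
Qed.

(** * The binomial kernel *)

(** For l <= m this is m!^2 / ((m-l)! (m+l)!); it vanishes for l > m, so sums over l may stop
    anywhere past m. *)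
Definition binr (R : numFieldType) (m l : nat) : R :=
  'C(m.*2, m + l)%:R / 'C(m.*2, m)%:R.

Lemma binr_small (R : numFieldType) m l : (m < l)%N -> binr R m l = 0.
Proof. by move=> ml; rewrite /binr bin_small ?mul0r // -addnn ltn_add2l. Qed.

Lemma binr0 (R : numFieldType) m : binr R m 0 = 1.
Proof.
by rewrite /binr addn0 divff // pnatr_eq0 -lt0n bin_gt0 -addnn leq_addr.
Qed.

Lemma binr_ge0 (R : numFieldType) m l : 0 <= binr R m l.
Proof. by rewrite divr_ge0. Qed.

Lemma binrS (R : numFieldType) m l :
  (m%:R - l%:R) * binr R m l = (m%:R + l%:R + 1) * binr R m l.+1.
Proof.
have [ml|lm] := ltnP m l; first by rewrite !binr_small ?mulr0 // ltnW.
rewrite /binr !mulrA; congr (_ / _).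
rewrite -natrB // -natrD natr1 -!natrM -addnS addnS mul_bin_left.
by rewrite -addnn subnDl.
Qed.

(** In other words, the increment of the kernel from m to m+1 is l^2 / (m+1)^2 times its value at
    m+1. *)
Lemma binrSl (R : numFieldType) m l :
  (m.+1%:R ^+ 2 - l%:R ^+ 2) * binr R m.+1 l = m.+1%:R ^+ 2 * binr R m l.
Proof.
elim: l => [|l IHl]; first by rewrite !binr0 expr0n subr0.
have ml0 : m%:R + l%:R + 1 != 0 :> R by rewrite -natrD natr1 pnatr_eq0.
apply: (mulfI ml0); have /esym ES := binrS R m.+1 l.
have /esym E := binrS R m l; rewrite -!natr1 in ES IHl *.
rewrite [RHS]mulrCA E [RHS]mulrCA -IHl; apply/eqP; rewrite -subr_eq0; apply/eqP.
have -> : m%:R + l%:R + 1 = (m%:R + 1 + l%:R + 1) - 1 :> R by ring.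
transitivity (((m%:R + l%:R + 1) * (m%:R - l%:R)) *
 ((m%:R + 1 + l%:R + 1) * binr R m.+1 l.+1 - (m%:R + 1 - l%:R) * binr R m.+1 l)).
  by ring.
by rewrite ES subrr mulr0.
Qed.

Lemma binr_diag (R : numFieldType) m n : (m <= n)%N ->
  m%:R * binr R m n = n%:R * binr R m n.
Proof. by rewrite leq_eqVlt => /predU1P[-> //|/binr_small ->]; rewrite !mulr0. Qed.

(** Writing b_l for [binr R m l], [binrS] gives (m-l) b_l - (m-l-1) b_(l+1) = 2 (l+1) b_(l+1), which
    telescopes from k to n, where (m-n) b_n = 0. A factor m is traded for a tail sum. *)
Lemma binr_sum (R : numFieldType) m k n : (m <= n)%N ->
  m%:R * binr R m k =
  k%:R * binr R m k + 2 * \sum_(k.+1 <= l < n.+1) l%:R * binr R m l.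
Proof.
move=> mn; have [nk|kn] := ltnP n k.
  by rewrite big_geq ?ltnS 1?ltnW // binr_small ?(leq_ltn_trans mn) // !mulr0 addr0.
have [d] : exists d, n = (k + d)%N by exists (n - k)%N; rewrite subnKC.
elim: d k {kn} => [|d IHd] k kn.
  by rewrite addn0 in kn; rewrite -kn big_geq // mulr0 addr0 binr_diag.
have /esym E := binrS R m k.
rewrite big_ltn ?ltnS; last by rewrite kn addnS ltnS leq_addr.
rewrite mulrDr -[in RHS]natr1.
have {IHd} := IHd k.+1; rewrite addSnnS => /(_ kn); rewrite -[in X in X -> _]natr1.
move: (\sum_(_ <= l < _) _) => S E2.
apply/eqP; rewrite -subr_eq0; apply/eqP.
transitivity ((m%:R - k%:R) * binr R m k -(m%:R + k%:R + 1) * binr R m k.+1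
 + (m%:R * binr R m k.+1 - ((k%:R+1) * binr R m k.+1 + 2 * S))); first ring.
by rewrite E E2 !subrr addr0.
Qed.

(** [binrS] also reads l b_l + (l+1) b_(l+1) = m (b_l - b_(l+1)), to be summed with alternating
    signs. A factor 1/m is traded for an alternating tail sum. *)
Lemma binr_altsum (R : numFieldType) m k n : (m <= n)%N ->
  k%:R * binr R m k =
  m%:R * (binr R m k
    + 2 * \sum_(k.+1 <= l < n.+1) (-1) ^+ (l + k) * binr R m l).
Proof.
move=> mn; have [nk|kn] := ltnP n k.
  by rewrite big_geq ?ltnS 1?ltnW // binr_small ?(leq_ltn_trans mn) // !mulr0 addr0 mulr0.
have [d] : exists d, n = (k + d)%N by exists (n - k)%N; rewrite subnKC.
elim: d k {kn} => [|d IHd] k kn.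
  by rewrite addn0 in kn; rewrite -kn big_geq // mulr0 addr0 binr_diag.
have /esym E := binrS R m k.
rewrite big_ltn ?ltnS; last by rewrite kn addnS ltnS leq_addr.
have {IHd} := IHd k.+1; rewrite addSnnS => /(_ kn); rewrite -[in X in X -> _]natr1.
have -> : \sum_(k.+2 <= l < n.+1) (-1) ^+ (l + k.+1) * binr R m l =
    - \sum_(k.+2 <= l < n.+1) (-1) ^+ (l + k) * binr R m l.
  by rewrite -sumrN; apply: eq_bigr => l _; rewrite addnS exprS mulN1r mulNr.
rewrite addSn addnn -mul2n exprS exprM sqrrN expr1n expr1n mulr1 mulN1r.
move: (\sum_(_ <= l < _) _) => S E2.
apply/eqP; rewrite -subr_eq0; apply/eqP.
transitivity ((m%:R + k%:R + 1) * binr R m k.+1 - (m%:R - k%:R) * binr R m k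
 - ((k%:R+1) * binr R m k.+1 - m%:R * (binr R m k.+1 + 2 * - S))); first ring.
by rewrite E E2 !subrr.
Qed.

Lemma binr_le1 (R : realFieldType) m l : binr R m l <= 1.
Proof.
elim: l => [|l IHl]; first by rewrite binr0.
have [ml|lm] := ltnP m l.+1; first by rewrite binr_small.
apply: le_trans IHl; have := binrS R m l; have := binr_ge0 R m l.
have : 0 <= m%:R - l%:R :> R by rewrite subr_ge0 ler_nat ltnW.
have := ler0n R l; have := ler0n R m; nra.
Qed.

(** Passing from l to l+1 costs at most (2l+1) / (m+1), and these odd numbers add up to a square.
    With [binr_le1] this bounds the distance of the kernel from 1. *)
Lemma binr_ge (R : realFieldType) m l :
  1 - l%:R ^+ 2 / m.+1%:R <= binr R m l.
Proof.
elim: l => [|l IHl]; first by rewrite binr0 expr0n mul0r subr0.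
have m0 : 0 < m.+1%:R :> R by rewrite ltr0n.
have E : binr R m l.+1 = binr R m l -
    (2 * l%:R + 1) * binr R m l / (m.+1%:R + l%:R).
  have /esym := binrS R m l; rewrite -natr1.
  have ml0 : m%:R + l%:R + 1 != 0 :> R by rewrite -natrD natr1 pnatr_eq0.
  move=> E; apply: (mulfI ml0); rewrite E; field.
  by rewrite [1 + _]addrC addrAC.
have : (2 * l%:R + 1) * binr R m l / (m.+1%:R + l%:R) <= (2 * l%:R + 1) / m.+1%:R.
  rewrite ler_pM ?mulr_ge0 ?binr_ge0 ?invr_ge0 ?addr_ge0 ?mulr_ge0 //.
    by rewrite ler_piMr ?binr_le1 ?addr_ge0 ?mulr_ge0.
  by rewrite lef_pV2 ?posrE ?ltr_wpDr // lerDl.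
have -> : l.+1%:R ^+ 2 / m.+1%:R = l%:R ^+ 2 / m.+1%:R + (2 * l%:R + 1) / m.+1%:R :> R.
  by rewrite -(natr1 l) -mulrDl; congr (_ / _); ring.
rewrite E; move: IHl; set x := _ / (_ + _).
by set y := _ / m.+1%:R; set z := (_ + _) / _; lra.
Qed.

Lemma big_triangle (V : nmodType) (G : nat -> nat -> V) m n :
  \sum_(m <= l < n) \sum_(l.+1 <= k < n) G l k =
  \sum_(m <= k < n) \sum_(m <= l < k) G l k.
Proof.
elim: n => [|n IHn]; first by rewrite !big_geq.
have [nm|mn] := ltnP n m; first by rewrite !big_geq.
rewrite [RHS]big_nat_recr //= [LHS]big_nat_recr //= [X in _ + X]big_geq //.
rewrite addr0 -IHn -big_split.
rewrite big_nat [RHS]big_nat; apply: eq_bigr => l /andP[_ ln].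
by rewrite big_nat_recr.
Qed.

(** * Truncated sums expanded on the kernel *)

(** The coefficients do not depend on [m]. The value m = 0 is excluded: there [zsum R [::]] is 1
    while the sum over l is empty. *)
Definition binr_rep (R : realType) (ks : seq nat) (c : nat -> R) :=
  forall m, (0 < m)%N ->
    zsum R ks m = \sum_(1 <= l < m.+1) binr R m l * c l.

Lemma eq_binr_rep (R : realType) ks (c d : nat -> R) :
  (forall l, (0 < l)%N -> c l = d l) -> binr_rep ks c -> binr_rep ks d.
Proof.
move=> cd ksc m m0; rewrite ksc // big_nat [RHS]big_nat.
by apply: eq_bigr => l /andP[l0 _]; rewrite cd.
Qed.

(** The case k = 0 of [binr_altsum], solved for 1. *)
Lemma binr_rep_nil (R : realType) :
  binr_rep [::] (fun l => - 2 * (-1) ^+ l : R).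
Proof.
move=> m m0; have := binr_altsum R 0 (leqnn m); rewrite mul0r binr0.
under eq_bigr do rewrite addn0.
have mn0 : m%:R != 0 :> R by rewrite pnatr_eq0 -lt0n.
move=> /esym/eqP; rewrite mulf_eq0 (negbTE mn0) /= => /eqP E.
transitivity (- (2 * \sum_(1 <= l < m.+1) (-1) ^+ l * binr R m l)).
  by apply/eqP; rewrite -subr_eq0 opprK E.
by rewrite mulr_sumr -sumrN; apply: eq_bigr => l _; ring.
Qed.

(** Induction on N, the increment of the kernel being given by [binrSl]. [F] is arbitrary so that it
    may also be m or 1/m times a truncated sum. *)
Lemma sum_binr (R : realType) (F c : nat -> R) :
  (forall m, (0 < m)%N -> F m = \sum_(1 <= l < m.+1) binr R m l * c l) ->
  forall N, \sum_(1 <= m < N.+1) m%:R ^- 2 * F m =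
    \sum_(1 <= l < N.+1) binr R N l * (c l / l%:R ^+ 2).
Proof.
move=> Fc; elim=> [|N IHN]; first by rewrite !big_geq.
rewrite big_nat_recr //= IHN Fc // mulr_sumr.
have -> : \sum_(1 <= l < N.+1) binr R N l * (c l / l%:R ^+ 2) =
   \sum_(1 <= l < N.+2) binr R N l * (c l / l%:R ^+ 2).
  by rewrite [RHS]big_nat_recr //= binr_small // mul0r addr0.
rewrite -big_split big_nat [RHS]big_nat; apply: eq_bigr => l /andP[l0 _] /=.
have N0 : N.+1%:R != 0 :> R by rewrite pnatr_eq0.
have ln0 : l%:R != 0 :> R by rewrite pnatr_eq0 -lt0n.
have -> : binr R N l = (N.+1%:R ^+ 2 - l%:R ^+ 2) * binr R N.+1 l / N.+1%:R ^+ 2.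
  by rewrite binrSl mulrAC mulfV ?mul1r // expf_neq0.
by move: N0; rewrite -natr1 => N0; field; rewrite ln0.
Qed.

Lemma binr_rep2 (R : realType) ks (c : nat -> R) :
  binr_rep ks c -> binr_rep (2%N :: ks) (fun l => c l / l%:R ^+ 2).
Proof. by move=> ksc m m0; exact: sum_binr. Qed.

(** Since 1/m = m^-2 m, [binr_sum] absorbs the factor m and the order of summation is exchanged. *)
Lemma binr_rep1 (R : realType) ks (c : nat -> R) : binr_rep ks c ->
  binr_rep (1%N :: ks) (fun l => (c l + 2 * \sum_(1 <= k < l) c k) / l%:R).
Proof.
move=> ksc N N0 /=.
under eq_big_nat => m /andP[m0 _].
  rewrite (_ : _ * _ = m%:R ^- 2 * (m%:R * zsum R ks m)); last first.
    by rewrite mulrA; congr (_ * _); field; rewrite pnatr_eq0 -lt0n.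
  over.
rewrite (@sum_binr _ _ (fun l => l%:R * (c l + 2 * \sum_(1 <= k < l) c k))).
  apply: eq_big_nat => l /andP[l0 _].
  by congr (_ * _); field; rewrite pnatr_eq0 -lt0n.
move=> m m0; rewrite ksc // mulr_sumr.
under eq_bigr => l _ do rewrite mulrA (binr_sum _ _ (leqnn m)) mulrDl.
transitivity (\sum_(1 <= l < m.+1) binr R m l * (l%:R * c l) +
  \sum_(1 <= l < m.+1) \sum_(l.+1 <= k < m.+1) 2 * (k%:R * binr R m k * c l)).
  rewrite -big_split; apply: eq_bigr => l _ /=; congr (_ + _); first ring.
  by rewrite -mulrA mulr_suml mulr_sumr.
rewrite big_triangle -big_split; apply: eq_bigr => l _ /=.
rewrite -mulr_sumr -mulr_sumr; ring.
Qed.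

(** Since m^-3 = m^-2 (1/m), [binr_altsum] absorbs the factor 1/m. *)
Lemma binr_rep3 (R : realType) ks (c : nat -> R) : binr_rep ks c ->
  binr_rep (3%N :: ks) (fun l => (c l / l%:R +
     2 * \sum_(1 <= k < l) (-1) ^+ (l + k) * (c k / k%:R)) / l%:R ^+ 2).
Proof.
move=> ksc N N0 /=.
under eq_big_nat => m /andP[m0 _].
  rewrite (_ : _ * _ = m%:R ^- 2 * (zsum R ks m / m%:R)); last first.
    by field; rewrite pnatr_eq0 -lt0n.
  over.
rewrite (@sum_binr _ _ (fun l => c l / l%:R +
     2 * \sum_(1 <= k < l) (-1) ^+ (l + k) * (c k / k%:R))) //.
move=> m m0; rewrite ksc // mulr_suml.
have mn0 : m%:R != 0 :> R by rewrite pnatr_eq0 -lt0n.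
transitivity (\sum_(1 <= l < m.+1) binr R m l * (c l / l%:R) +
  \sum_(1 <= l < m.+1) \sum_(l.+1 <= k < m.+1)
    2 * (binr R m k * ((-1) ^+ (k + l) * (c l / l%:R)))).
  rewrite -big_split; apply: eq_big_nat => l /andP[l0 _] /=.
  have ln0 : l%:R != 0 :> R by rewrite pnatr_eq0 -lt0n.
  have -> : binr R m l * c l / m%:R = l%:R * binr R m l / m%:R * (c l / l%:R).
    by field; rewrite ln0 mn0.
  rewrite (binr_altsum _ _ (leqnn m)) [m%:R * _]mulrC mulfK // mulrDl; congr (_ + _).
  rewrite -mulrA mulr_suml mulr_sumr; apply: eq_bigr => k _; ring.
rewrite big_triangle -big_split; apply: eq_bigr => l _ /=.
rewrite -mulr_sumr -mulr_sumr; ring.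
Qed.

Lemma binr_rep_nseq2 (R : realType) ks (c : nat -> R) j : binr_rep ks c ->
  binr_rep (nseq j 2%N ++ ks) (fun l => c l / l%:R ^+ j.*2).
Proof.
move=> ksc; elim: j => [|j IHj].
  by apply: eq_binr_rep ksc => l _; rewrite expr0 divr1.
apply: eq_binr_rep (binr_rep2 IHj) => l _.
by rewrite -mulrA -invfM -exprD addn2.
Qed.

Definition alt_inv (R : numFieldType) (j k : nat) : R :=
  (-1) ^+ k / k%:R ^+ j.*2.+2.

(* The coefficients, on the kernel binr, of the truncated zeta-star sum of
   {2}^{w_0},3,{2}^{w_1},1,... *)
Definition coef (R : numFieldType) (w : seq nat) (l : nat) : R :=
  if w is j :: w' then
    alt_inv R j l * (isum (@alt_inv R) w' l + isum (@alt_inv R) w' l.-1)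
  else - 2 * (-1) ^+ l.

(** For a nonempty word, [isum] is the summatory function of [coef]; for the empty word both sides
    equal 2. *)
Lemma coef_sum (R : numFieldType) w l : (0 < l)%N ->
  coef R w l + 2 * \sum_(1 <= k < l) coef R w k =
  isum (@alt_inv R) w l + isum (@alt_inv R) w l.-1.
Proof.
case: l => // l _; case: w => [|j w].
  rewrite /=; elim: l => [|l IHl]; first by rewrite big_geq //=; ring.
  by rewrite big_nat_recr //= -IHl exprS; ring.
have -> : isum (@alt_inv R) (j :: w) l.+1 =
    isum (@alt_inv R) (j :: w) l + coef R (j :: w) l.+1.
  by rewrite /= big_nat_recr.
have -> : \sum_(1 <= k < l.+1) coef R (j :: w) k =
  isum (@alt_inv R) (j :: w) l.+1.-1 by [].
move: (coef _ _ _) (isum _ _ _) => x y /=; ring.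
Qed.

(** The block is prefixed from right to left. The exponents 1 and 3 each supply a divisor k,
    completing k^(2b) to the k^(2b+2) of [alt_inv]; of the sign (-1)^(l+k) due to 3, (-1)^k is
    cancelled and (-1)^l passes to [alt_inv R a l]. *)
Lemma binr_rep_block (R : realType) ks w a b : binr_rep ks (coef R w) ->
  binr_rep (nseq a 2%N ++ 3%N :: nseq b 2%N ++ 1%N :: ks) (coef R (a :: b :: w)).
Proof.
move=> /binr_rep1/(binr_rep_nseq2 b)/binr_rep3/(binr_rep_nseq2 a).
apply: eq_binr_rep => l l0.
have E k : (0 < k)%N ->
    (coef R w k + 2 * \sum_(1 <= i < k) coef R w i) / k%:R / k%:R ^+ b.*2 / k%:R
    = (-1) ^+ k * coef R (b :: w) k.
  move=> k0; rewrite coef_sum // /coef /alt_inv 2!exprS.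
  rewrite -[(-1) ^+ k / _ * _]mulrA signrMK.
  by field; rewrite expf_neq0 pnatr_eq0 -lt0n.
rewrite E // (eq_big_nat _ _ (F2 := fun k => (-1) ^+ l * coef R (b :: w) k)).
  rewrite -mulr_sumr [2 * _]mulrCA -mulrDr coef_sum // [RHS]/coef.
  set X := isum _ _ _ + _; rewrite /alt_inv -(addn2 a.*2) exprD.
  by field; rewrite expf_neq0 pnatr_eq0 -lt0n l0.
by move=> k /andP[k0 _]; rewrite E // exprD -mulrA signrMK.
Qed.

Lemma binr_rep_idxA (R : realType) n (J : nat -> nat) :
  binr_rep (idxA n J) (coef R [seq J i | i <- iota 0 n.*2]).
Proof.
rewrite /idxA; set g := fun i => nseq (J i.*2) 2%N ++ _.
(* The induction peels off the first block, so the starting block [k] must vary. *)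
suff gen k : binr_rep (flatten [seq g i | i <- iota k n])
    (coef R [seq J i | i <- iota k.*2 n.*2]) by exact: (gen 0%N).
elim: n k => [|n IHn] k /=; first exact: binr_rep_nil.
have := binr_rep_block (J k.*2) (J k.*2.+1) (IHn k.+1).
by rewrite /g -catA /= -catA.
Qed.

Lemma binr_rep_twos (R : realType) j :
  binr_rep (nseq j.+1 2%N) (fun l => - coef R [:: j] l).
Proof.
rewrite -[nseq _ _]cats0; apply: eq_binr_rep (binr_rep_nseq2 j.+1 (binr_rep_nil R)).
by move=> l _; rewrite /= /alt_inv doubleS; ring.
Qed.

(** * Passage to the limit *)

Lemma sum_invsq_tail (R : realType) L n : (0 < L)%N ->
  \sum_(L.+1 <= k < n) k%:R ^- 2 <= L%:R^-1 :> R.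
Proof.
move=> L0; have [nL|Ln] := leqP n L; first by rewrite big_geq // ltnW.
(* The upper end is kept so that k^-2 <= 1/(k-1) - 1/k telescopes. *)
suff : \sum_(L.+1 <= k < n) k%:R ^- 2 <= L%:R^-1 - n.-1%:R^-1 :> R.
  by move=> /le_trans; apply; rewrite lerBlDr lerDl invr_ge0.
elim: n Ln => // n IHn; rewrite ltnS leq_eqVlt => /predU1P[<-|Ln].
  by rewrite big_geq //= subrr.
rewrite big_nat_recr //=; apply: le_trans (lerD (IHn Ln) (lexx _)) _.
have n0 : (0 < n.-1)%N by rewrite (leq_trans L0) // -ltnS prednK // (leq_trans _ Ln).
case: n n0 {IHn Ln} => [//|n] /= n0.
suff : n.+1%:R ^- 2 <= n%:R^-1 - n.+1%:R^-1 :> R.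
  by move: (_ ^- 2) (n%:R^-1) (n.+1%:R^-1) (L%:R^-1) => x y z t; lra.
have -> : n%:R^-1 - n.+1%:R^-1 = (n%:R * n.+1%:R)^-1 :> R.
  by rewrite -(natr1 n); field; rewrite natr1 !pnatr_eq0 -!lt0n n0.
by rewrite lef_pV2 ?posrE ?mulr_gt0 ?exprn_gt0 ?ltr0n // expr2 ler_wpM2r // ler_nat.
Qed.

Lemma sum_invsq_le2 (R : realType) n : \sum_(1 <= k < n) k%:R ^- 2 <= 2 :> R.
Proof.
have [n1|n1] := leqP n 1; first by rewrite big_geq.
rewrite big_ltn //; have := @sum_invsq_tail R 1 n isT; rewrite invr1 expr1n invr1; lra.
Qed.

Lemma cvg_sum_invsq (R : realType) (c : nat -> R) C :
  (forall l, (0 < l)%N -> `|c l| <= C * l%:R ^- 2) ->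
  cvgn (fun N => \sum_(1 <= l < N.+1) c l).
Proof.
move=> cC.
have -> : (fun N => \sum_(1 <= l < N.+1) c l) = series (fun k => c k.+1).
  by apply/funext => N; rewrite /series /= big_add1.
apply: normed_cvg.
have C0 : 0 <= C.
  by have := le_trans (normr_ge0 _) (cC 1%N isT); rewrite expr1n invr1 mulr1.
apply: nondecreasing_is_cvgn.
  by apply: nondecreasing_series => k _ _; exact: normr_ge0.
exists (C * 2) => _ [n _ <-].
have -> : [normed series (fun k => c k.+1)] n = \sum_(1 <= k < n.+1) `|c k|.
  by rewrite big_add1.
apply: (@le_trans _ _ (\sum_(1 <= k < n.+1) C * k%:R ^- 2)).
  by apply: ler_sum_nat => k /andP[k0 _]; exact: cC.
by rewrite -mulr_sumr ler_wpM2l // sum_invsq_le2.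
Qed.

(** Cut at L: by [binr_ge] each error with l <= L is at most C / (N+1), and past L the inverse
    squares sum to at most 1/L. *)
Lemma cvg_sum_binr (R : realType) (c : nat -> R) C :
  (forall l, (0 < l)%N -> `|c l| <= C * l%:R ^- 2) ->
  (fun N => \sum_(1 <= l < N.+1) binr R N l * c l - \sum_(1 <= l < N.+1) c l)
    @ \oo --> (0 : R).
Proof.
move=> cC.
have C0 : 0 <= C.
  by have := le_trans (normr_ge0 _) (cC 1%N isT); rewrite expr1n invr1 mulr1.
apply/cvgr0Pnorm_le => e e0.
pose L := (Num.truncn (C * 2 / e)).+1.
have L0 : 0 < L%:R :> R by rewrite ltr0n.
have LC : 2 * C / L%:R <= e.
  rewrite ler_pdivrMr // -ler_pdivrMl // mulrC [2 * C]mulrC ltW //.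
  by rewrite truncnS_gt.
(* For N >= L^2 the L head terms also total at most C / L, so the whole error is at most 2C / L <=
   e. *)
exists (L * L)%N => // N /= LN; apply: le_trans LC.
rewrite -sumrB.
have LN1 : (L < N.+1)%N by rewrite ltnS (leq_trans _ LN) // leq_pmulr.
have diff l : (0 < l)%N -> `|binr R N l * c l - c l| <= C * l%:R ^- 2 * (1 - binr R N l).
  move=> l0; rewrite -[X in _ - X]mul1r -mulrBl normrM distrC mulrC.
  rewrite (@ger0_norm _ (1 - _)) ?subr_ge0 ?binr_le1 //.
  by rewrite ler_wpM2r ?subr_ge0 ?binr_le1 // cC.
apply: le_trans (ler_norm_sum _ _ _) _.
rewrite (@big_cat_nat _ _ _ L.+1) //=.
have -> : 2 * C / L%:R = C / L%:R + C / L%:R by rewrite -mulrDl; congr (_ / _); ring.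
apply: lerD.
  apply: (@le_trans _ _ (\sum_(1 <= l < L.+1) C / N.+1%:R)).
    apply: ler_sum_nat => l /andP[l0 _]; apply: le_trans (diff l l0) _.
    rewrite -mulrA ler_wpM2l // ler_pdivrMl ?exprn_gt0 ?ltr0n //.
    by rewrite lerBlDl -lerBlDr binr_ge.
  rewrite sumr_const_nat subn1 /= -[X in X <= _]mulr_natr -mulrA ler_wpM2l //.
  rewrite ler_pdivrMl ?ltr0n // ler_pdivlMr // -natrM ler_nat.
  exact: leq_trans LN _.
apply: (@le_trans _ _ (\sum_(L.+1 <= l < N.+1) C * l%:R ^- 2)).
  apply: ler_sum_nat => l /andP[Ll _]; have l0 : (0 < l)%N by case: l Ll.
  apply: le_trans (diff l l0) _.
  rewrite ler_piMr ?mulr_ge0 ?invr_ge0 ?exprn_ge0 //.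
  by rewrite lerBlDr lerDl binr_ge0.
by rewrite -mulr_sumr ler_wpM2l // sum_invsq_tail.
Qed.

Lemma isum_bound (R : realType) (T : Type) (f : T -> nat -> R) w :
  (forall a k, (0 < k)%N -> `|f a k| <= k%:R ^- 2) ->
  exists2 C, 0 <= C & forall l, `|isum f w l| <= C.
Proof.
move=> fb; elim: w => [|a w [C C0 IHw]] /=; first by exists 1 => // l; rewrite normr1.
exists (2 * (C + C)) => [|l]; first by rewrite mulr_ge0 ?addr_ge0.
apply: le_trans (ler_norm_sum _ _ _) _.
apply: (@le_trans _ _ (\sum_(1 <= k < l.+1) k%:R ^- 2 * (C + C))).
  apply: ler_sum_nat => k /andP[k0 _]; rewrite normrM ler_pM ?fb //.
  by rewrite (le_trans (ler_normD _ _)) // lerD.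
by rewrite -mulr_suml ler_wpM2r ?addr_ge0 ?sum_invsq_le2.
Qed.

(** * Limits that are rational multiples of powers of pi *)

(** Convergence is part of the predicate, so that limits can be added and multiplied. *)
Definition qpi_cvg (R : realType) (u : nat -> R) (w : nat) : Prop :=
  exists q : rat, u @ \oo --> ratr q * pi ^+ w.

Lemma qpi_cvg1 (R : realType) : qpi_cvg (fun=> 1 : R) 0.
Proof. by exists 1; rewrite rmorph1 expr0 mulr1; exact: cvg_cst. Qed.

Lemma qpi_cvgM (R : realType) (u v : nat -> R) w1 w2 :
  qpi_cvg u w1 -> qpi_cvg v w2 -> qpi_cvg (fun n => u n * v n) (w1 + w2).
Proof.
move=> [p up] [q vq]; exists (p * q).
by rewrite rmorphM exprD mulrACA; exact: cvgM.
Qed.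

Lemma qpi_cvgD (R : realType) (u v : nat -> R) w :
  qpi_cvg u w -> qpi_cvg v w -> qpi_cvg (fun n => u n + v n) w.
Proof.
move=> [p up] [q vq]; exists (p + q).
by rewrite rmorphD mulrDl; exact: cvgD.
Qed.

Lemma qpi_cvg_sum (R : realType) (T : eqType) (r : seq T) (u : T -> nat -> R) w :
  (forall i, i \in r -> qpi_cvg (u i) w) ->
  qpi_cvg (fun n => \sum_(i <- r) u i n) w.
Proof.
elim: r => [_|a r IHr ur].
  exists 0; rewrite rmorph0 mul0r.
  under eq_fun do rewrite big_nil.
  exact: cvg_cst.
under eq_fun do rewrite big_cons.
apply: qpi_cvgD; first by apply: ur; rewrite mem_head.
by apply: IHr => i ir; apply: ur; rewrite inE ir orbT.
Qed.

(** [symsum_newton] either splits off a one-letter sum or merges three letters into one; the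
    remaining list gets shorter and the total weight is kept. *)
Lemma symsum_qpi (R : realType) :
  (forall j, qpi_cvg (isum (@alt_inv R) [:: j]) j.*2.+2) ->
  forall s, qpi_cvg (symsum (@alt_inv R) s) (\sum_(j <- s) j.*2.+2).
Proof.
move=> H1 s; have [n] := ubnP (size s); elim: n => // n IHn in s *; rewrite ltnS.
case: s => [_|g s /= sn]; first by rewrite big_nil; exact: qpi_cvg1.
(* (2a+2) + (2b+2) + (2c+2) = 2(a+b+c+2) + 2, and three signs (-1)^k multiply to one. *)
pose mul a b c := (a + b + c).+2.
have fM a b c k : alt_inv R (mul a b c) k = alt_inv R a k * alt_inv R b k * alt_inv R c k.
  have altE d : alt_inv R d k = (-1) ^+ k * k%:R^-1 ^+ d.*2.+2.
    by rewrite exprVn.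
  rewrite !altE.
  have -> : (mul a b c).*2.+2 = (a.*2.+2 + b.*2.+2 + c.*2.+2)%N by rewrite /mul; lia.
  move: a.*2.+2 b.*2.+2 c.*2.+2 => x y z.
  by rewrite !exprD -[LHS](signrMK k); ring.
rewrite (_ : symsum _ _ = fun l => isum (@alt_inv R) [:: g] l * symsum (@alt_inv R) s l
    + \sum_(p <- picks s) \sum_(q <- picks p.2)
        symsum (@alt_inv R) (mul g p.1 q.1 :: q.2) l); last first.
  by apply/funext => l; exact: symsum_newton.
rewrite big_cons; apply: qpi_cvgD; first exact: qpi_cvgM (H1 g) (IHn s sn).
apply: qpi_cvg_sum => p ps; apply: qpi_cvg_sum => q qs.
rewrite (big_picks_sum _ ps) (big_picks_sum _ qs).
have -> : (g.*2.+2 + (p.1.*2.+2 + (q.1.*2.+2 + \sum_(j <- q.2) j.*2.+2)) =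
    \sum_(j <- mul g p.1 q.1 :: q.2) j.*2.+2)%N.
  by rewrite big_cons /mul; move: (\sum_(_ <- _) _)%N p.1 q.1 => x y z; lia.
by apply: IHn; rewrite /= -(size_picks qs) ltnW // -(size_picks ps).
Qed.

(** * Zeta-star values as limits of weighted sums *)

Lemma normr_alt_inv (R : realType) a k : (0 < k)%N ->
  `|alt_inv R a k| <= k%:R ^- 2.
Proof.
move=> k0; rewrite normrM normrX normrN1 expr1n mul1r ger0_norm ?invr_ge0 ?exprn_ge0 //.
rewrite lef_pV2 ?posrE ?exprn_gt0 ?ltr0n //.
by apply: ler_weXn2l; rewrite ?ler1n.
Qed.

Lemma coef_bound (R : realType) a w : exists C, forall l, (0 < l)%N ->
  `|coef R (a :: w) l| <= C * l%:R ^- 2.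
Proof.
have [C C0 wC] := isum_bound w (@normr_alt_inv R); exists (C + C) => l l0.
rewrite normrM mulrC ler_pM ?normr_alt_inv //.
by rewrite (le_trans (ler_normD _ _)) // lerD.
Qed.

(** By [cvg_sum_binr] the kernel may be replaced by 1 in the limit. *)
Lemma zetastar_rep (R : realType) ks (c : nat -> R) C : binr_rep ks c ->
  (forall l, (0 < l)%N -> `|c l| <= C * l%:R ^- 2) ->
  (fun N => \sum_(1 <= l < N.+1) c l) @ \oo --> zetastar R ks.
Proof.
move=> ksc cC; have cc := cvg_sum_invsq cC.
suff -> : zetastar R ks = limn (fun N => \sum_(1 <= l < N.+1) c l) by [].
apply: cvg_lim => //.
rewrite -[limn _]add0r; apply: cvg_trans (cvgD (cvg_sum_binr cC) cc).
apply: near_eq_cvg; exists 1%N => // N /= N0.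
by rewrite [LHS]subrK ksc.
Qed.

(** [0 < n] makes the word nonempty, so its coefficients are O(l^-2); their partial sums are [isum]
    by definition. *)
Lemma isum_cvg_idxA (R : realType) n (J : nat -> nat) : (0 < n)%N ->
  isum (@alt_inv R) [seq J i | i <- iota 0 n.*2] @ \oo --> zetastar R (idxA n J).
Proof.
move=> n0; have := @binr_rep_idxA R n J.
have : size [seq J i | i <- iota 0 n.*2] != 0%N.
  by rewrite size_map size_iota double_eq0 -lt0n.
case: [seq J i | i <- _] => // a w _ rep; have [C wC] := coef_bound R a w.
exact: zetastar_rep rep wC.
Qed.

Lemma isum1_cvg (R : realType) j :
  isum (@alt_inv R) [:: j] @ \oo --> - zetastar R (nseq j.+1 2%N).
Proof.
have [C wC] := coef_bound R j [::].
have bC l : (0 < l)%N -> `|- coef R [:: j] l| <= C * l%:R ^- 2.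
  by move=> l0; rewrite normrN wC.
have -> : isum (@alt_inv R) [:: j] =
    - (fun N => \sum_(1 <= l < N.+1) - coef R [:: j] l).
  by apply/funext => N; rewrite fctE sumrN opprK.
exact: cvgN (zetastar_rep (binr_rep_twos R j) bC).
Qed.

(** The symmetric group on one letter is trivial, so (B_0) concerns the single value of [zetastar]
    at j+1 twos. *)
Lemma qpi_isum1 (R : realType) j : stmtB R 0 ->
  qpi_cvg (isum (@alt_inv R) [:: j]) j.*2.+2.
Proof.
move=> /(_ (fun=> j))[q]; rewrite big_ord1 muln0 addn0 mul2n addn2 => Eq.
exists (- q); rewrite rmorphN mulNr -Eq.
rewrite (eq_bigr (fun=> zetastar R (nseq j.+1 2%N))) => [|s _].
  by rewrite sumr_const card_Sn; exact: isum1_cvg.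
by rewrite /idxB /= /permj insubT.
Qed.

Theorem theorem1p4 (R : realType) (n : nat) :
  (0 < n)%N ->
  (forall l : nat, (1 <= l < n)%N -> stmtA R l) ->
  (forall l : nat, (l < n)%N -> stmtB R l) ->
  stmtA R n.
Proof.
move=> n0 _ B j.
have [q qs] := symsum_qpi (fun k => qpi_isum1 k (B 0%N n0))
  [seq j i | i <- enum 'I_(n.*2)].
exists q.
have -> : (2 * (\sum_(i < n.*2) j i) + 4 * n =
   \sum_(k <- [seq j i | i <- enum 'I_(n.*2)]) k.*2.+2)%N.
  rewrite big_map big_enum /= big_distrr /=.
  under [RHS]eq_bigr do rewrite -addn2 -mul2n.
  rewrite [in RHS]big_split /= sum_nat_const card_ord; congr (_ + _)%N; last by lia.
(* The same sequence also tends to the sum of zeta-star values, and limits are unique. *)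
apply/esym/(cvg_unique _ qs) => //.
rewrite (_ : symsum _ _ = fun l => \sum_(s : 'S_(n.*2))
    isum (@alt_inv R) [seq permj s j i | i <- iota 0 n.*2] l); last first.
  by apply/funext => l; rewrite sum_perm_isum.
by apply: cvg_big => [|s _]; [exact: add_continuous | exact: isum_cvg_idxA].
Qed.
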